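(* Fix an integer $s\geq 2$. Let $N=\binom{n}{2}$ and let $e_{i,j}$, $i=1,\dots,N$, $j=1,\dots,s$, be $s$ independent uniformly random orderings of the edge set $E(K_n)$ of the complete graph $K_n$ (so for each $j$, $(e_{1,j},\dots,e_{N,j})$ is a uniformly random permutation of $E(K_n)$, independently over $j$). For $I\subseteq[N]$ and $j\in[s]$ let $E_{I,j}=\{e_{i,j}:i\in I\}$. Call $I\subseteq[N]$ a MultiTree if for every $j=1,\dots,s$ the edge set $E_{I,j}$ forms a spanning tree of $K_n$. Let $m^*$ be the smallest $m$ such that $[m]=\{1,\dots,m\}$ contains a MultiTree. Then $m^*=O(n\log n)$ with high probability, i.e. there is a constant $C$ (independent of $n$) such that $\Pr(m^*\le Cn\log n)\to 1$ as $n\to\infty$.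
   Context: With high probability (w.h.p.) means with probability tending to 1 as $n\to\infty$. *)

(* Defs.v *)
From mathcomp Require Import all_boot all_order all_algebra.
From mathcomp Require Import all_classical all_reals all_analysis.
Set Implicit Arguments.
Unset Strict Implicit.
Unset Printing Implicit Defensive.
Import Order.TTheory GRing.Theory Num.Theory.
Import numFieldNormedType.Exports.
Local Open Scope ring_scope.

(* A simple graph on the vertex set 'I_n is given by its set of edges, each   *)
(* edge being a two-element set of vertices.                                  *)

Definition complete_edges (n : nat) : {set {set 'I_n}} :=
  [set e : {set 'I_n} | #|e| == 2%N].

Definition adj (n : nat) (F : {set {set 'I_n}}) : rel 'I_n :=
  [rel u v | (u != v) && ([set u; v] \in F)].

Definition connected_graph (n : nat) (F : {set {set 'I_n}}) : bool :=
  [forall u, forall v, connect (adj F) u v].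

(* A cycle has at least three vertices, all distinct; hence it has at most n  *)
(* of them, which makes the quantification finite (see acyclic_graphP).       *)
Definition acyclic_graph (n : nat) (F : {set {set 'I_n}}) : bool :=
  [forall k : 'I_n.+1, forall c : k.-tuple 'I_n,
     (2 < k)%N ==> ~~ ucycleb (adj F) c].

Lemma acyclic_graphP (n : nat) (F : {set {set 'I_n}}) :
  reflect (forall c : seq 'I_n, (2 < size c)%N -> ~ ucycle (adj F) c)
          (acyclic_graph F).
Proof.
apply: (iffP forallP) => [acF c c_gt2 uc | acF k].
  have lt_cn : (size c < n.+1)%N.
    have /andP[_ uniq_c] := uc.
    by rewrite ltnS -[leqRHS]card_ord -(card_uniqP uniq_c) max_card.
  have /forallP/(_ (in_tuple c)) := acF (Ordinal lt_cn).
  by rewrite /= c_gt2 /= => /negP.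
apply/forallP => c; apply/implyP => k_gt2; apply/negP.
by apply: acF; rewrite size_tuple.
Qed.

Definition spanning_tree (n : nat) (F : {set {set 'I_n}}) : bool :=
  [&& F \subset complete_edges n, connected_graph F & acyclic_graph F].

(* Indices are 0-based: position i : 'I_'C(n, 2) stands for the (i+1)-st edge. *)
Definition ordering (n : nat) : finType :=
  {f : {ffun 'I_'C(n, 2) -> {set 'I_n}} |
    injectiveb f && (f @: [set: 'I_'C(n, 2)] == complete_edges n)}.

(* The sample space: with its uniform probability, the s coordinates are      *)
(* independent uniformly random orderings (see Pr_product).                   *)
Definition orderings (s n : nat) : finType := {ffun 'I_s -> ordering n}.

Definition Pr (R : realType) (T : finType) (A : {set T}) : R :=
  #|A|%:R / #|T|%:R.

Lemma card_complete_edges (n : nat) : #|complete_edges n| = 'C(n, 2).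
Proof. by rewrite card_draws card_ord. Qed.

Lemma ordering_gt0 (n : nat) : (0 < #|ordering n|)%N.
Proof.
have ltE (i : 'I_'C(n, 2)) : (i < #|complete_edges n|)%N.
  by rewrite card_complete_edges.
pose f : {ffun 'I_'C(n, 2) -> {set 'I_n}} :=
  [ffun i => enum_val (Ordinal (ltE i))].
have injf : injective f.
  move=> i j; rewrite !ffunE => /enum_val_inj/(congr1 val) /= eij.
  exact: val_inj.
have fP : injectiveb f && (f @: [set: 'I_'C(n, 2)] == complete_edges n).
  apply/andP; split; first exact/injectiveP.
  rewrite eqEcard card_imset// cardsT card_ord card_complete_edges leqnn andbT.
  by apply/fintype.subsetP => _ /imsetP[i _ ->]; rewrite ffunE enum_valP.
by apply/card_gt0P; exists (exist _ f fP : ordering n).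
Qed.

Lemma Pr_product (R : realType) (s n : nat) (A : 'I_s -> {set ordering n}) :
  Pr R [set w : orderings s n | [forall j, w j \in A j]] =
  \prod_(j < s) Pr R (A j).
Proof.
rewrite /Pr prodf_div prodr_const card_ord; congr (_ / _).
  rewrite -natr_prod; congr (_%:R).
  transitivity #|family (fun j => mem (A j))|.
    by apply: eq_card => w; rewrite !inE.
  by rewrite card_family foldrE big_map big_enum.
by rewrite card_ffun card_ord natrX.
Qed.

Definition edges_at (s n : nat) (w : orderings s n) (I : {set 'I_'C(n, 2)})
    (j : 'I_s) : {set {set 'I_n}} :=
  [set val (w j) i | i in I].

Definition MultiTree (s n : nat) (w : orderings s n) (I : {set 'I_'C(n, 2)}) :
    bool :=
  [forall j : 'I_s, spanning_tree (edges_at w I j)].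

Definition prefix_set (n m : nat) : {set 'I_'C(n, 2)} :=
  [set i : 'I_'C(n, 2) | (i < m)%N].

Definition prefix_contains_MultiTree (s n : nat) (w : orderings s n) (m : nat) :
    bool :=
  [exists I : {set 'I_'C(n, 2)}, (I \subset prefix_set n m) && MultiTree w I].

(* Some outcomes admit no MultiTree at all; m* is then +oo, the minimum of    *)
(* the empty family.                                                          *)
Definition mstar (R : realType) (s n : nat) (w : orderings s n) : \bar R :=
  \big[Order.min/+oo%E]_(m < 'C(n, 2).+1 | prefix_contains_MultiTree w m)
    (m%:R%:E : \bar R).

Lemma mstarP (R : realType) (s n : nat) (w : orderings s n) (m : nat) :
  mstar R w = m%:R%:E <->
  prefix_contains_MultiTree w m /\
  (forall k, prefix_contains_MultiTree w k -> (m <= k)%N).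
Proof.
have lb k : prefix_contains_MultiTree w k -> (mstar R w <= k%:R%:E)%E.
  move=> Pk; have [lek|gtk] := leqP k 'C(n, 2).
    by rewrite /mstar (bigmin_le_cond _ (j := Ordinal (lek : k < _.+1)%N)).
  have PN : prefix_contains_MultiTree w 'C(n, 2).
    have /existsP[I /andP[_ MI]] := Pk; apply/existsP; exists I.
    by rewrite MI andbT; apply/fintype.subsetP => i _; rewrite inE.
  apply: (@le_trans _ _ ('C(n, 2)%:R%:E)); last by rewrite lee_fin ler_nat ltnW.
  by rewrite /mstar (bigmin_le_cond _ (j := ord_max)).
have attained : mstar R w = +oo%E \/
    exists2 k, prefix_contains_MultiTree w k & mstar R w = k%:R%:E.
  rewrite /mstar; elim/big_rec: _ => [|i x Pi]; first by left.
  move=> IH; rewrite minEle; case: ifP => _; last exact: IH.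
  by right; exists i.
split=> [mE | [Pm min_m]].
  case: attained => [|[k Pk]]; rewrite mE // => -[] /eqP.
  rewrite eqr_nat => /eqP mk; split=> [|j /lb]; first by rewrite mk.
  by rewrite mE lee_fin ler_nat.
case: attained => [oo|[k Pk kE]]; first by have := lb _ Pm; rewrite oo.
apply/eqP; rewrite eq_le lb//= kE lee_fin ler_nat; exact: min_m.
Qed.

(* Main.v *)
Require Import Defs.
From mathcomp Require Import all_boot all_order all_algebra.
From mathcomp Require Import all_fingroup zify.
From mathcomp Require Import all_classical all_reals all_analysis.
Import Order.TTheory GRing.Theory Num.Theory.
Import numFieldNormedType.Exports.
Set Implicit Arguments.
Unset Strict Implicit.
Unset Printing Implicit Defensive.

(* It is enough to find MultiTrees all of whose trees are Hamilton paths.     *)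
(* A family (S th) of sets of n - 1 rows (s-tuples of edges), given by s      *)
(* paths and s orderings of their edges, is spread: a fraction at most        *)
(* (O(n) / N ^ s) ^ t of it contains a given set of t rows.  As in the proofs *)
(* of the spread lemma, reveal the orderings in O(log n) blocks of O(n) rows, *)
(* and follow, for a random th, the size of the smallest T \subset S th which *)
(* together with the revealed rows contains a member of the family.  With     *)
(* high probability each block halves this size until it is a constant rho,   *)
(* and a last block of O(n log n) rows brings it to 0.                        *)
(*   A row of the orderings excludes the rows that share an edge with it, so  *)
(* the usual counting, which adds T to the set of revealed rows, is replaced  *)
(* by a switching: T is planted into the current block by transpositions of   *)
(* positions.  After the switching T lies in a set of at most r rows that can *)
(* be computed from the new orderings and the former positions of the edges   *)
(* of T, which leaves at most 'C(r, t) choices for it.                        *)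

(** An index [th] consists, for each [j], of a Hamilton path and an order of its edges; the [k]-th
    row of the member collects the [k]-th edges of the [s] paths. A set of [t] rows fixes the labels
    in at most [n ^ t] ways and then [t] edges per coordinate, which gives the spread with
    [K = 16 ^ s * n] ([path_rows_spread]).

    One round ([round_le]) fails only if a core [T] of [t > r'] rows is still missing. It can be
    planted into the block in at least [(L * K) ^ t] ways. Each result is determined by the switched
    orderings, the old positions [q], [T] and [th] ([trace_inj]). The [N ^ (s * t)] choices of [q]
    are paid for by the spread, which leaves [K ^ t], and [T] has ['C(r, t)] choices
    ([core_decode]). So a core of size [t] has probability at most ['C(r, t) / L ^ t].

    With [L = 16] a round halves the fragment ([halving_rounds]); a last round with [L] of order
    [log n] removes it ([unlikely_uncovered]). A Hamilton path is a spanning tree, so a covered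
    member yields a MultiTree ([covers_MultiTree]). *)

Lemma card_pairset (A B : finType) (Y : {set A * B}) :
  #|Y| = \sum_(a : A) #|[set b | (a, b) \in Y]|.
Proof.
rewrite -sum1_card (eq_bigl (fun y => true && ((y.1, y.2) \in Y))); last first.
  by case.
rewrite -(pair_big_dep xpredT (fun a b => (a, b) \in Y) (fun _ _ => 1)) /=.
by apply: eq_bigr => a _; rewrite -sum1_card; apply: eq_bigl => b; rewrite inE.
Qed.

Lemma card_pairset_le (A B : finType) (Y : {set A * B}) (U : {set A}) k :
    (forall a b, (a, b) \in Y -> a \in U) ->
    (forall a, a \in U -> #|[set b | (a, b) \in Y]| <= k) ->
  #|Y| <= #|U| * k.
Proof.
move=> YU leYk; rewrite card_pairset -sum_nat_const (bigID (mem U)) /=.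
rewrite [X in _ + X]big1 ?addn0; last first.
  move=> a aU; apply/eqP; rewrite cards_eq0 -finset.subset0;
    apply/fintype.subsetP => b.
  by rewrite inE => /YU; rewrite (negPf aU).
by apply: leq_sum => a; exact: leYk.
Qed.

Lemma card_pairset_ge (A B : finType) (Y : {set A * B}) (U : {set A}) k :
    (forall a, a \in U -> k <= #|[set b | (a, b) \in Y]|) ->
  #|U| * k <= #|Y|.
Proof.
move=> leYk; rewrite card_pairset -sum_nat_const [leqRHS](bigID (mem U)) /=.
by apply: leq_trans (leq_addr _ _); apply: leq_sum => a; exact: leYk.
Qed.

(** * Products of disjoint transpositions *)

Section Swap.
Variables (P : finType) (t : nat) (p q : 'I_t -> P).

Definition swap : {perm P} := (\prod_(i < t) tperm (p i) (q i))%g.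

Lemma swap_out z : (forall i, z != p i) -> (forall i, z != q i) -> swap z = z.
Proof.
move=> zp zq; rewrite /swap; elim/big_rec: _ => [|i x _ IH];
  first by rewrite perm1.
by rewrite permM tpermD // eq_sym.
Qed.

(** The points involved are all distinct, so only the [i]-th transposition moves [p i]. *)
Lemma swap_in i : injective p -> injective q -> (forall i j, p i != q j) ->
  swap (p i) = q i.
Proof.
move=> injp injq pq; rewrite /swap.
have: i \in index_enum 'I_t by rewrite mem_index_enum.
elim: (index_enum _) (index_enum_uniq 'I_t) => //= a l IH /andP[al ul].
rewrite big_cons permM inE; have [-> _|ia /= il] := eqVneq i a.
  rewrite tpermL; elim: l al {IH ul} => [|b l IH].
    by rewrite big_nil perm1.
  rewrite inE negb_or big_cons permM => /andP[ib il].
  have bi : q b != q a by rewrite (inj_eq injq) eq_sym.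
  by rewrite (tpermD (pq _ _) bi) IH.
have ai : p a != p i by rewrite (inj_eq injp) eq_sym.
have qi : q a != p i by rewrite eq_sym.
by rewrite (tpermD ai qi) IH.
Qed.

End Swap.

Lemma card_bigcup_le_sum (I T : finType) (C : pred I) (F : I -> {set T}) :
  #|\bigcup_(i | C i) F i| <= \sum_(i | C i) #|F i|.
Proof.
elim/big_ind2: _ => [|U m U' m' h h'|//]; first by rewrite cards0.
by apply: leq_trans (leq_card_setU _ _) _; exact: leq_add.
Qed.

Lemma card_bigcup_le (I T : finType) (C : pred I) (F : I -> {set T}) k :
  (forall i, C i -> #|F i| <= k) -> #|\bigcup_(i | C i) F i| <= #|C| * k.
Proof.
move=> Fk; apply: leq_trans (card_bigcup_le_sum _ _) _.
by rewrite -sum_nat_const; exact: leq_sum.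
Qed.

Lemma leq_expn_base a b e : a <= b -> a ^ e <= b ^ e.
Proof. by move=> ab; elim: e => // e IH; rewrite !expnS leq_mul. Qed.

(** * Switchings *)

Section Switching.
Variables (s : nat) (j0 : 'I_s) (P : finType) (z0 : P).

Notation X := {ffun 'I_s -> P}.
Notation Omega := {ffun 'I_s -> {perm P}}.

Definition row (w : Omega) (z : P) : X := [ffun j => w j z].

Lemma row_inj w : injective (row w).
Proof. by move=> y z /ffunP/(_ j0); rewrite !ffunE => /perm_inj. Qed.

Variables (Theta : finType) (S : Theta -> {set X}) (r0 : nat).
Hypothesis matchS : forall th x y j, x \in S th -> y \in S th ->
  x j = y j -> x = y.
Hypothesis cardS : forall th, #|S th| <= r0.

Definition covers (w : Omega) (A : {set P}) (T : {set X}) : bool :=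
  [exists th, S th \subset (row w @: A) :|: T].

Definition frag (w : Omega) (A : {set P}) (th : Theta) (k : nat) : bool :=
  [exists T : {set X}, [&& T \subset S th, #|T| <= k & covers w A T]].

Section Round.
Variables (A B : {set P}) (r r' : nat).
Hypothesis disjAB : forall z, z \in A -> z \in B -> False.

Definition bad (d : Omega * Theta) : bool :=
  frag d.1 A d.2 r && ~~ frag d.1 (A :|: B) d.2 r'.

(* c.1 completes the rows revealed at A to the member S c.2 of the family;    *)
(* best minimises what c.1 still misses once the block B is revealed too.     *)
Definition cand (w : Omega) (th : Theta) (c : {set X} * Theta) : bool :=
  [&& #|c.1| <= r, c.1 \subset (row w @: B) :|: S th, c.1 \subset S c.2
    & S c.2 \subset (row w @: A) :|: c.1].

Definition best (w : Omega) (th : Theta) : {set X} * Theta :=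
  odflt (finset.set0, th)
    [pick c | cand w th c &&
      [forall c', cand w th c' ==> (#|c.1 :\: row w @: B| <= #|c'.1 :\: row w
        @: B|)]].

Definition core w th : {set X} := (best w th).1 :\: row w @: B.

Lemma bestP w th : bad (w, th) ->
  cand w th (best w th) /\
  (forall c, cand w th c -> #|core w th| <= #|c.1 :\: row w @: B|).
Proof.
case/andP=> /existsP[T /and3P[/= TS Tr /existsP[th' covT]]] _.
(* The witness of [frag] is cut down to [S th'], since a candidate must lie inside the member that
   it completes. *)
have c0 : cand w th (T :&: S th', th').
  rewrite /cand /=; apply/and4P; split.
  - by apply: leq_trans (subset_leq_card (finset.subsetIl _ _)) Tr.
  - apply: fintype.subset_trans (fintype.subset_trans (finset.subsetIl _ _) TS)
      (finset.subsetUr _ _).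
  - exact: finset.subsetIr.
  - apply/fintype.subsetP => x xS; have := fintype.subsetP covT x xS.
    by rewrite !inE xS andbT.
rewrite /core /best; case: pickP => [c /andP[cc /forallP minc]|].
  by split=> // c' /(implyP (minc c')).
pose F (c : {set X} * Theta) := #|c.1 :\: row w @: B|.
move=> /(_ [arg min_(c < (T :&: S th', th') | cand w th c) F c]).
case: arg_minnP => // c cc minc; rewrite cc /= => /negP[].
by apply/forallP => c'; apply/implyP; exact: minc.
Qed.

(** A core of at most [r'] rows would itself witness [frag] at [A :|: B], because the rest of
    [(best w th).1] is revealed in [B]. *)
Lemma bad_core w th : bad (w, th) ->
  core w th \subset S th /\ r' < #|core w th| <= r.
Proof.
move=> bwth; have [/and4P[c1 c2 c3 c4] _] := bestP bwth.
have cS : core w th \subset S th.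
  apply/fintype.subsetP => x /finset.setDP[xb xB].
  by have := fintype.subsetP c2 x xb; rewrite inE (negPf xB).
split=> //; apply/andP; split; last first.
  by apply: leq_trans (subset_leq_card (finset.subsetDl _ _)) c1.
have /andP[_ nf] := bwth; rewrite ltnNge; apply: contra nf => le.
apply/existsP; exists (core w th); rewrite cS le /=; apply/existsP.
exists (best w th).2; apply: fintype.subset_trans c4 _.
apply/fintype.subsetP => x; rewrite /core imsetU !inE.
by case: (x \in _ @: A) => //=; case: (x \in _ @: B).
Qed.

Section Core.
Variable t : nat.

Definition elt (T : {set X}) (i : 'I_t) : X := nth (row 1%g z0) (enum T) i.

Lemma elt_inj (T : {set X}) : #|T| = t -> injective (elt T).
Proof.
move=> Tt i j /eqP; rewrite nth_uniq ?enum_uniq -?cardE ?Tt // => /eqP.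
exact: val_inj.
Qed.

Lemma elt_in (T : {set X}) i : #|T| = t -> elt T i \in T.
Proof. by move=> Tt; rewrite -mem_enum mem_nth // -cardE Tt. Qed.

Lemma eltP (T : {set X}) x : #|T| = t -> x \in T -> exists i, x = elt T i.
Proof.
move=> Tt; rewrite -mem_enum => xT; have := xT; rewrite -index_mem -cardE Tt.
by move=> lt; exists (Ordinal lt); rewrite /elt nth_index.
Qed.

Notation QT := {ffun 'I_s * 'I_t -> P}.

Definition qpos (w : Omega) (T : {set X}) : QT :=
  [ffun a => ((w a.1)^-1)%g (elt T a.2 a.1)].

Definition qset (q : QT) : {set P} := [set q a | a in [set: 'I_s * 'I_t]].

(** With [q = qpos w T], ordering [j] brings its entry of [elt T i] from [q (j, i)] to [p i], so
    that a row scattered over [s] positions is assembled at one. *)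
Definition switch (w : Omega) (p : {ffun 'I_t -> P}) (q : QT) : Omega :=
  [ffun j => (swap p (fun i => q (j, i)) * w j)%g].

(* In a switched w the positions qset q carry junk and are ignored.           *)
Definition decode (w : Omega) (q : QT) : {set X} :=
  odflt finset.set0 (omap fst
    [pick c : {set X} * Theta |
      [&& #|c.1| <= r, c.1 \subset row w @: (B :\: qset q), c.1 \subset S c.2
        & S c.2 \subset (row w @: (A :\: qset q)) :|: c.1]]).

(* Positions of the block at which core w th may be planted without           *)
(* destroying a row of the completed member.                                  *)
Definition slots w th : {set P} :=
  B :\: qset (qpos w (core w th)) :\: [set z | row w z \in S (best w th).2].

Lemma switchE w (p : {ffun _}) q j z :
  switch w p q j z = w j (swap p (fun i => q (j, i)) z).
Proof. by rewrite ffunE permM. Qed.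

Lemma row_switch_out w (p : {ffun _}) q z :
    (forall i, z != p i) -> z \notin qset q ->
  row (switch w p q) z = row w z.
Proof.
move=> zp zq; apply/ffunP => j; rewrite !ffunE permM swap_out // => i.
by apply: contraNneq zq => ->; apply/imsetP; exists (j, i).
Qed.

Section Planted.
Variables (w : Omega) (th : Theta) (p : {ffun 'I_t -> P}).
Hypotheses (bwth : bad (w, th)) (coret : #|core w th| = t).
Hypotheses (injp : injective p) (pslot : forall i, p i \in slots w th).
Let T := core w th.
Let q := qpos w T.
Let w' := switch w p q.

Lemma qposP j i : w j (q (j, i)) = elt T i j.
Proof. by rewrite ffunE permKV. Qed.

Lemma p_notin_qset i : p i \notin qset q.
Proof. by have := pslot i; rewrite !inE => /and3P[_]. Qed.

(** For fixed [j] the positions [q (j, i)] are distinct by [matchS], and [slots] avoids them, so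
    [swap_in] applies. *)
Lemma row_planted i : row w' (p i) = elt T i.
Proof.
have [/and4P[c1 c2 c3 c4] _] := bestP bwth.
have TS : T \subset S (best w th).2 by apply: fintype.subset_trans c3;
  exact: finset.subsetDl.
apply/ffunP => j; rewrite ffunE switchE swap_in ?qposP // => [i1 i2 eqq|i1 i2].
  apply: (elt_inj coret); apply: (@matchS (best w th).2 _ _ j).
  - by apply: (fintype.subsetP TS); exact: elt_in.
  - by apply: (fintype.subsetP TS); exact: elt_in.
  by rewrite -!qposP eqq.
by apply: contraNneq (p_notin_qset i1) => ->; apply/imsetP; exists (j, i2).
Qed.

(** The row at such a [z] shares an entry with a row of [T]; by [matchS] two rows of one member that
    share an entry are equal. *)
Lemma qsetP z x :
  z \in qset q -> row w z = x -> x \in S (best w th).2 -> x \in T.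
Proof.
have [/and4P[c1 c2 c3 c4] _] := bestP bwth.
have TS : T \subset S (best w th).2 by apply: fintype.subset_trans c3;
  exact: finset.subsetDl.
case/imsetP=> -[j i] _ zE rowx xS.
have eT : elt T i \in T by exact: elt_in.
suff <- : elt T i = x by [].
apply: (@matchS (best w th).2 _ _ j) => //.
  exact: (fintype.subsetP TS).
by rewrite -rowx ffunE zE qposP.
Qed.

(** [qsetP] keeps [z] off [qset q] and [slots] keeps it off the planting positions, so the switching
    does not touch it. *)
Lemma row_kept x z : x \in S (best w th).2 -> x \notin T -> row w z = x ->
  z \notin qset q /\ row w' z = x.
Proof.
move=> xS xT rowx; have zq : z \notin qset q.
  by apply: contra xT => zq; exact: (qsetP zq rowx).
split=> //; rewrite row_switch_out // => i.
apply/eqP => zp; have := pslot i; rewrite !inE -zp rowx => /and3P[].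
by rewrite xS.
Qed.

(** [decode] finds a pair because [best w th] qualifies in [w']. Conversely a pair found in [w'] is
    a candidate in [w], as outside [qset q] the only new rows are those of [T], all in [B]. What it
    misses from the block lies in [T], hence is all of [T] by minimality of the core. *)
Lemma core_decode : #|decode w' q| <= r /\ T \subset decode w' q.
Proof.
have [/and4P[c1 c2 c3 c4] minT] := bestP bwth.
have [TS _] := bad_core bwth.
rewrite /decode; case: pickP => [[T'' th''] /= /and4P[d1 d2 d3 d4]|];
  last first.
  move=> /(_ (best w th)) /negP[]; apply/and4P; split=> //.
    apply/fintype.subsetP => x xb; have xS := fintype.subsetP c3 x xb.
    have [xT|xT] := boolP (x \in T).
      have [i ->] := eltP coret xT.
      apply/imsetP; exists (p i); last by rewrite row_planted.
      by have := pslot i; rewrite !inE => /and3P[_ -> ->].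
    have : x \in row w @: B.
      by apply: contraR xT => xB; rewrite /T /core inE xB.
    case/imsetP=> z zB xE; have [zq rz] := row_kept xS xT (esym xE).
    by apply/imsetP; exists z => //; rewrite inE zq.
  apply/fintype.subsetP => x xS; rewrite inE.
  have [xb|xb] := boolP (x \in (best w th).1); first by rewrite orbT.
  have := fintype.subsetP c4 x xS; rewrite inE (negPf xb) !orbF.
  have xT : x \notin T by apply: contra xb => /finset.setDP[].
  case/imsetP=> z zA xE; have [zq rz] := row_kept xS xT (esym xE).
  by apply/imsetP; exists z => //; rewrite inE zq.
split=> //.
have sB : row w' @: (B :\: qset q) \subset (row w @: B) :|: T.
  apply/fintype.subsetP => _ /imsetP[z /finset.setDP[zB zq] ->].
  have [/existsP[i /eqP ->]|] := boolP [exists i, z == p i].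
    by rewrite row_planted inE (elt_in _ coret) orbT.
  rewrite negb_exists => /forallP zp.
  by rewrite row_switch_out // inE; apply/orP; left; apply/imsetP; exists z.
have sA : row w' @: (A :\: qset q) \subset row w @: A.
  apply/fintype.subsetP => _ /imsetP[z /finset.setDP[zA zq] ->].
  rewrite row_switch_out //; first by apply/imsetP; exists z.
  move=> i; apply/eqP => zp; have := pslot i; rewrite !inE -zp => /and3P[_ _].
  exact: disjAB.
have candT : cand w th (T'', th'').
  rewrite /cand /= d1 d3 /= (fintype.subset_trans d2) /=; last first.
    exact: fintype.subset_trans sB (finset.setUS _ TS).
  exact: fintype.subset_trans d4 (finset.setSU _ sA).
have sub : T'' :\: row w @: B \subset T.
  apply/fintype.subsetP => x /finset.setDP[/(fintype.subsetP
    (fintype.subset_trans d2 sB))].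
  by rewrite inE => /orP[->|].
have /eqP <- : T'' :\: row w @: B == T.
  by rewrite eqEcard sub; exact: (minT _ candT).
exact: finset.subsetDl.
Qed.

End Planted.

Section Count.
Variables (L K : nat).
Hypothesis K_gt0 : 0 < K.
Hypothesis cardB : s.+2 * r0 + L * K <= #|B|.
Hypothesis spread : forall T : {set X},
  #|[set th | T \subset S th]| * #|P| ^ (s * #|T|) <= #|Theta| * K ^ #|T|.

Definition bad_at : {set Omega * Theta} :=
  [set d : Omega * Theta | bad d && (#|core d.1 d.2| == t)].

Definition bad_slot : {set (Omega * Theta) * {ffun 'I_t -> P}} :=
  [set d : (Omega * Theta) * {ffun 'I_t -> P} | (d.1 \in bad_at) &&
     (injectiveb d.2 && [forall i, d.2 i \in slots d.1.1 d.1.2])].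

(** At most [s * r0] positions are lost to [qset] and [r0] to the completed member; the last [r0] of
    [s.+2 * r0] pays for [t], so that [#|slots w th| ^_ t] is at least [(L * K) ^ t]. *)
Lemma card_slots w th : bad (w, th) -> #|core w th| = t ->
  t + L * K <= #|slots w th|.
Proof.
move=> bwth coret; have [TS _] := bad_core bwth.
have t_le : t <= r0 by rewrite -coret (leq_trans (subset_leq_card TS)).
have Qle : #|qset (qpos w (core w th))| <= s * r0.
  apply: leq_trans (leq_imset_card _ _) _.
  by rewrite cardsT card_prod !card_ord leq_mul2l t_le orbT.
have Rle : #|[set z | row w z \in S (best w th).2]| <= r0.
  rewrite -(card_imset _ (@row_inj w)); apply: leq_trans (cardS (best w th).2).
  by apply/subset_leq_card/fintype.subsetP => _ /imsetP[z + ->]; rewrite inE.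
rewrite /slots; set Q := qset _ in Qle *; set R := [set z | _] in Rle *.
have h1 : #|(B :\: Q) :&: R| <= r0 by rewrite (leq_trans (subset_leq_card
  (finset.subsetIr _ _))).
have h2 : #|B :&: Q| <= s * r0 by rewrite (leq_trans (subset_leq_card
  (finset.subsetIr _ _))).
rewrite !cardsD; move: cardB; rewrite !mulSn; lia.
Qed.

Lemma bad_slot_ge : #|bad_at| * (L * K) ^ t <= #|bad_slot|.
Proof.
apply: card_pairset_ge => -[w th] dbad.
have := dbad; rewrite inE /= => /andP[bwth /eqP coret].
have -> : #|[set b | ((w, th), b) \in bad_slot]| = #|slots w th| ^_ t.
  rewrite -[X in _ ^_ X]card_ord -card_inj_ffuns_on; apply: eq_card => f.
  rewrite !inE /= in dbad *; rewrite dbad /= andbC; congr (_ && _).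
have := card_slots bwth coret; move: #|slots w th| => m.
move: (L * K) => g {coret}; elim: t m => // u IH m le.
case: m le => [|m le]; first by [].
rewrite expnS ffactnS; apply: leq_mul; first by lia.
by apply: IH; lia.
Qed.

Definition trace (d : (Omega * Theta) * {ffun 'I_t -> P}) :
    ((QT * Omega) * {set X}) * Theta :=
  let T := core d.1.1 d.1.2 in let q := qpos d.1.1 T in
  (((q, switch d.1.1 d.2 q), T), d.1.2).

(* The rows of the core show where they have been planted, so the positions   *)
(* d.2 need not be recorded.                                                  *)
Lemma trace_inj : {in bad_slot &, injective trace}.
Proof.
move=> [[w1 th1] p1] [[w2 th2] p2] d1 d2.
move: d1; rewrite 2!inE /= => /andP[/andP[b1 /eqP c1] /andP[/injectiveP i1
  /forallP s1]].
move: d2; rewrite 2!inE /= => /andP[/andP[b2 /eqP c2] /andP[/injectiveP i2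
  /forallP s2]].
case=> qq ww TT tt; have pp : p1 = p2.
  apply/ffunP => i; apply: (@row_inj (switch w1 p1 (qpos w1 (core w1 th1)))).
  by rewrite (row_planted b1 c1 i1 s1) ww (row_planted b2 c2 i2 s2) TT.
congr ((_, _), _) => //.
apply/ffunP => j; move/ffunP/(_ j): ww; rewrite !ffunE pp qq.
exact: mulgI.
Qed.

Lemma bad_slot_le : #|bad_slot| <= #|[set: Omega * Theta]| * 'C(r, t) * K ^ t.
Proof.
rewrite -(card_in_imset trace_inj).
pose U : {set (QT * Omega) * {set X}} :=
  [set u : (QT * Omega) * {set X} | (#|decode u.1.2 u.1.1| <= r) &&
     ((u.2 \subset decode u.1.2 u.1.1) && (#|u.2| == t))].
pose Y : {set ((QT * Omega) * {set X}) * Theta} :=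
  [set y : ((QT * Omega) * {set X}) * Theta | (y.1 \in U) && (y.1.2 \subset S
    y.2)].
have sub : trace @: bad_slot \subset Y.
  apply/fintype.subsetP => _ /imsetP[[[w th] p] + ->]; rewrite 2!inE /=.
  move=> /andP[/andP[bwth /eqP coret] /andP[/injectiveP injp /forallP ps]].
  have [h1 h2] := core_decode bwth coret injp ps.
  by rewrite !inE /= h1 h2 coret eqxx /=; have [] := bad_core bwth.
apply: leq_trans (subset_leq_card sub) _.
(* [N] counts the maps [q], and [k] bounds the number of [th] with [T \subset S th]; as
   [k * N <= #|Theta| * K ^ t], the spread cancels the cost of recording [q]. *)
pose N := #|P| ^ (s * t); pose k := (#|Theta| * K ^ t) %/ N.
have N0 : 0 < N by rewrite expn_gt0 -[#|P|]cardsT; apply/orP; left;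
  apply/card_gt0P; exists z0; rewrite inE.
have cU : #|U| <= #|[set: QT * Omega]| * 'C(r, t).
  apply: card_pairset_le => [a b _|[q w] _]; first by rewrite inE.
  have [le|gt] := leqP #|decode w q| r; last first.
    by rewrite eq_card0 // => T; rewrite !inE /= leqNgt gt.
  apply: leq_trans (leq_bin2l t le); rewrite -cards_draws.
  by apply/subset_leq_card/fintype.subsetP => T; rewrite !inE => /andP[].
have cY : #|Y| <= #|U| * k.
  apply: card_pairset_le => [a b|[[q w] T] TU]; first by rewrite inE => /andP[].
  have := TU; rewrite inE /= => /and3P[_ _ /eqP Tt].
  have := spread T; rewrite Tt => spT; rewrite leq_divRL //.
  apply: leq_trans spT.
  by rewrite leq_mul2r; apply/orP; right; apply/subset_leq_card/fintype.subsetP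
    => th; rewrite !inE => /andP[].
apply: leq_trans cY _; apply: leq_trans (leq_mul cU (leqnn _)) _.
have cQ : #|[set: QT * Omega]| = N * #|Omega|.
  by rewrite cardsT card_prod card_ffun card_prod !card_ord.
rewrite cQ cardsT card_prod.
have : k * N <= #|Theta| * K ^ t by exact: leq_trunc_div.
move: (K ^ t) 'C(r, t) #|Omega| #|Theta| => a b c d h.
have := leq_mul h (leqnn (c * b)); lia.
Qed.

Lemma bad_at_le : #|bad_at| * L ^ t <= #|[set: Omega * Theta]| * 'C(r, t).
Proof.
have := leq_trans bad_slot_ge bad_slot_le.
by rewrite expnMn mulnA leq_pmul2r // expn_gt0 K_gt0.
Qed.

End Count.
End Core.

(** The bad pairs are split by the size [t] of the core, and the binomials of [bad_at_le] sum to at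
    most [2 ^ r]. *)
Lemma round_le L K Lam : 0 < K -> s.+2 * r0 + L * K <= #|B| ->
    (forall T : {set X}, #|[set th | T \subset S th]| * #|P| ^ (s * #|T|) <=
                         #|Theta| * K ^ #|T|) ->
    (forall t, r' < t <= r -> Lam <= L ^ t) ->
  #|[set d | bad d]| * Lam <= #|[set: Omega * Theta]| * 2 ^ r.
Proof.
move=> K0 cB spr LamL.
have le_sum : #|[set d | bad d]| <= \sum_(t < r.+1) #|bad_at t|.
  apply: leq_trans (card_bigcup_le_sum xpredT _).
  apply/subset_leq_card/fintype.subsetP => -[w th]; rewrite inE => bd.
  have [_ /andP[_ le]] := bad_core bd.
  by apply/bigcupP; exists (Ordinal (le : #|core w th| < r.+1)) => //;
    rewrite inE bd /=.
apply: leq_trans (leq_mul le_sum (leqnn Lam)) _.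
rewrite big_distrl /= -[2]/(1 + 1)%N expnDn big_distrr /=.
apply: leq_sum => t _; rewrite !exp1n !muln1.
have [lt|le] := ltnP r' t.
  apply: leq_trans (@bad_at_le t L K K0 cB spr).
  by rewrite leq_mul2l LamL ?orbT // lt -ltnS ltn_ord.
rewrite [#|_|]eq_card0 // => -[w th]; rewrite !inE /=.
apply/negP => /andP[/bad_core[_ /andP[h _]] /eqP ct].
by move: h; rewrite ltnNge ct le.
Qed.

End Round.

Definition unfrag (A : {set P}) (k : nat) : {set Omega * Theta} :=
  [set d | ~~ frag d.1 A d.2 k].

Lemma unfrag_le (A B : {set P}) r r' :
  #|unfrag (A :|: B) r'| <= #|unfrag A r| + #|[set d | bad A B r r' d]|.
Proof.
apply: leq_trans (leq_card_setU _ _).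
apply/subset_leq_card/fintype.subsetP => d; rewrite !inE /bad => ->.
by rewrite andbT orNb.
Qed.

End Switching.

(** * Revealing successive blocks of positions *)

Definition pre (N m : nat) : {set 'I_N} := [set i : 'I_N | i < m].

Lemma card_pre N m : m <= N -> #|pre N m| = m.
Proof.
move=> le; rewrite -[RHS]card_ord -cardsT.
have inj : injective (widen_ord le) by move=> i j /(congr1 val) /= /val_inj.
rewrite -(card_imset _ inj).
apply: eq_card => i; rewrite inE; apply/idP/imsetP => [lt|[j _ ->]] /=.
  by exists (Ordinal lt) => //; exact: val_inj.
exact: (ltn_ord j).
Qed.

Section Iteration.
Variables (s : nat) (j0 : 'I_s) (N : nat) (z0 : 'I_N) (Theta : finType).
Variables (S : Theta -> {set {ffun 'I_s -> 'I_N}}) (r0 K : nat).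
Hypothesis matchS : forall th x y j, x \in S th -> y \in S th ->
  x j = y j -> x = y.
Hypothesis cardS : forall th, #|S th| <= r0.
Hypothesis K_gt0 : 0 < K.
Hypothesis spread : forall T : {set {ffun 'I_s -> 'I_N}},
  #|[set th | T \subset S th]| * N ^ (s * #|T|) <= #|Theta| * K ^ #|T|.

Let M := #|[set: {ffun 'I_s -> {perm 'I_N}} * Theta]|.

Lemma pre_round L Lam m r r' : m + (s.+2 * r0 + L * K) <= N ->
    (forall t, r' < t <= r -> Lam <= L ^ t) ->
  exists2 y, #|unfrag S (pre N (m + (s.+2 * r0 + L * K))) r'| <=
             #|unfrag S (pre N m) r| + y & y * Lam <= M * 2 ^ r.
Proof.
set b := _ + L * K => mb LamL.
pose B : {set 'I_N} := pre N (m + b) :\: pre N m.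
have sub : pre N m \subset pre N (m + b).
  by apply/fintype.subsetP => i; rewrite !inE => h;
    rewrite (leq_trans h) ?leq_addr.
have -> : pre N (m + b) = pre N m :|: B.
  by apply/finset.setP => i; rewrite /B !inE; case: (ltnP i m) => //= h;
    rewrite (leq_trans h) ?leq_addr.
exists #|[set d | bad S (pre N m) B r r' d]|; first exact: unfrag_le.
apply: (round_le j0 z0 matchS cardS _ K_gt0 _ _ LamL).
- by move=> z zm; rewrite !inE; rewrite inE in zm; rewrite zm.
- by rewrite /B cardsD (finset.setIidPr sub) !card_pre ?addKn // (leq_trans
    (leq_addr _ _) mb).
by move=> T; rewrite card_ord.
Qed.

(** Invariant: fragment bound [r] fails with probability at most [2 ^ (- r)]. From [r = 2 * r'], a
    round with [L = 16] adds at most [2 ^ r / 4 ^ r = 4 ^ (- r')], and twice [4 ^ (- r')] is at most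
    [2 ^ (- r')]. *)
Lemma halving_rounds rho a i : 0 < rho -> r0 <= rho * 2 ^ a -> i <= a ->
    i * (s.+2 * r0 + 16 * K) <= N ->
  #|unfrag S (pre N (i * (s.+2 * r0 + 16 * K))) (rho * 2 ^ (a - i))| *
    2 ^ (rho * 2 ^ (a - i)) <= M.
Proof.
move=> rho0 r0le; elim: i => [_ _|i IH lt le].
  rewrite [#|_|]eq_card0 // => -[w th]; rewrite !inE /=; apply/negbTE;
    rewrite negbK.
  apply/existsP; exists (S th); rewrite fintype.subxx subn0 (leq_trans (cardS
    th)) //=.
  by apply/existsP; exists th; rewrite finset.subsetUr.
move: le; rewrite mulSnr => le.
have := IH (ltnW lt) (leq_trans (leq_addr _ _) le).
have -> : a - i = (a - i.+1).+1 by lia.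
set r' := rho * 2 ^ (a - i.+1).
have -> : rho * 2 ^ (a - i.+1).+1 = 2 * r' by rewrite expnS mulnCA.
have r'0 : 0 < r' by rewrite muln_gt0 rho0 expn_gt0.
have [|y ley yM IHi] := pre_round (Lam := 4 ^ (2 * r')) (r := 2 * r') (r' :=
  r') le.
  move=> t /andP[tr _]; rewrite -[16]/(4 ^ 2) -expnM leq_exp2l //; lia.
have y2 : y * 2 ^ (2 * r') <= M.
  rewrite -(@leq_pmul2r (2 ^ (2 * r'))) ?expn_gt0 // -mulnA -expnMn.
  exact: yM.
have e2 : 2 * 2 ^ r' <= 2 ^ (2 * r') by rewrite -expnS leq_exp2l //; lia.
have := leq_mul ley e2.
move: (2 ^ (2 * r')) (2 ^ r') y2 IHi => u v y2 IHi h.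
rewrite -(@leq_pmul2r 2) //; nia.
Qed.

(** The halving rounds fail with probability at most [2 ^ (- rho)]; the last one, from [rho] to [0],
    adds at most [2 ^ rho / L]. *)
Lemma unlikely_uncovered rho a L : 0 < rho -> r0 <= rho * 2 ^ a ->
    0 < L -> 0 < #|Theta| ->
    a * (s.+2 * r0 + 16 * K) + (s.+2 * r0 + L * K) <= N ->
  #|[set w | ~~ covers S w (pre N (a * (s.+2 * r0 + 16 * K) + (s.+2 * r0 + L *
    K)))
             finset.set0]| * (2 ^ rho * L) <=
    #|{ffun 'I_s -> {perm 'I_N}}| * (L + 4 ^ rho).
Proof.
move=> rho0 r0le L0 Th0 le; set m := _ + _ in le *.
have := halving_rounds rho0 r0le (leqnn a) (leq_trans (leq_addr _ _) le).
rewrite subnn muln1 => h1.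
have [|y ley yM] := pre_round (Lam := L) (r := rho) (r' := 0) le.
  by move=> [|t] //; rewrite expnS => _; rewrite leq_pmulr // expn_gt0 L0.
set W := [set w | _].
(* An empty fragment does not depend on [th], so the average over [Theta] disappears. *)
have W_le : #|W| * #|Theta| <= #|unfrag S (pre N m) 0|.
  have -> : #|W| * #|Theta| = #|finset.setX W [set: Theta]| by rewrite cardsX
    cardsT.
  apply/subset_leq_card/fintype.subsetP => -[w th]; rewrite !inE andbT /=.
  apply: contra => /existsP[T /and3P[_]]; rewrite leqn0 cards_eq0 => /eqP ->.
  by [].
have ME : M = #|{ffun 'I_s -> {perm 'I_N}}| * #|Theta| by rewrite /M cardsT
  card_prod.
rewrite -(@leq_pmul2r #|Theta|) //.
have -> : 4 ^ rho = 2 ^ rho * 2 ^ rho by rewrite -expnMn.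
move: (2 ^ rho) h1 yM => u h1 yM.
have := leq_mul (leq_trans W_le ley) (leqnn (u * L)).
have := leq_mul h1 (leqnn L).
have := leq_mul yM (leqnn u).
rewrite -/m in ley *; move: (#|unfrag _ _ rho|) => x.
rewrite ME; move: #|{ffun _ -> _}| #|Theta| #|W| => A B C.
lia.
Qed.

End Iteration.

(** * Hamilton paths *)

(** Multiplying by the inverse of one solution [u0] turns the solutions into permutations fixing
    every [k i]. *)
Lemma card_perm_agree (T : finType) t (k l : 'I_t -> T) : injective k ->
  #|[set u : {perm T} | [forall i, u (k i) == l i]]| <= (#|T| - t)`!.
Proof.
move=> injk; set V := [set u | _].
have [->|[u0 u0V]] := set_0Vmem V; first by rewrite cards0.
have u0P i : u0 (k i) = l i by move: u0V; rewrite inE => /forallP/(_ i)/eqP.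
have -> : #|T| - t = #|~: (k @: [set: 'I_t])|.
  by rewrite cardsCs finset.setCK card_imset // cardsT card_ord.
rewrite -card_perm -(card_imset _ (mulIg u0^-1%g)).
apply/subset_leq_card/fintype.subsetP => _ /imsetP[u uV ->].
rewrite unfold_in; apply/fintype.subsetP => x; rewrite !inE permM => ux.
apply: contra ux => /imsetP[i _ ->].
by move: uV; rewrite inE => /forallP/(_ i)/eqP ->; rewrite -u0P permK.
Qed.

Section Paths.
Variable m : nat.

Notation n := m.+1.
Definition path_edge (u : {perm 'I_n}) (l : 'I_m) : {set 'I_n} :=
  [set u (widen_ord (leqnSn m) l); u (lift ord0 l)].

Lemma path_edge_neq (u : {perm 'I_n}) (l : 'I_m) :
  u (widen_ord (leqnSn m) l) != u (lift ord0 l).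
Proof. by rewrite (inj_eq perm_inj) -val_eqE /= /bump /=; lia. Qed.

Lemma card_path_edge u l : #|path_edge u l| = 2.
Proof. by rewrite cards2 path_edge_neq. Qed.

Lemma path_edge_inj u : injective (path_edge u).
Proof.
move=> l l' /finset.setP E; apply: val_inj => /=.
have := E (u (widen_ord (leqnSn m) l)); rewrite !inE eqxx /=.
have := E (u (lift ord0 l)); rewrite !inE eqxx orbT !(inj_eq perm_inj)
  -!val_eqE.
by rewrite /= /bump /= => /esym/orP[] /eqP + /esym/orP[] /eqP; lia.
Qed.

Section Oriented.
Variables (t : nat) (a : 'I_t -> {set 'I_n}) (h : 'I_t -> 'I_n).

Definition oriented (u : {perm 'I_n}) : bool :=
  [forall i, exists l, (path_edge u l == a i) && (u (lift ord0 l) == h i)].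

(** In [u] the other endpoint of [a i] comes right before [h i], at a position where [v] agrees; so
    [h i] follows it in [v] too. *)
Lemma oriented_step u v (k : 'I_n) i : oriented u -> oriented v ->
  (forall j : 'I_n, j < k -> u j = v j) -> u k = h i -> v k = h i.
Proof.
move=> /forallP/(_ i)/existsP[l /andP[/eqP ul /eqP uh]].
move=> /forallP/(_ i)/existsP[l' /andP[/eqP vl /eqP vh]] uv uk.
have kE : k = lift ord0 l by apply: (@perm_inj _ u); rewrite uk uh.
have pred_eq : u (widen_ord (leqnSn m) l) = v (widen_ord (leqnSn m) l').
  have : u (widen_ord (leqnSn m) l) \in a i by rewrite -ul finset.set21.
  rewrite -vl !inE => /orP[/eqP //|/eqP E].
  by have := path_edge_neq u l; rewrite E vh uh eqxx.
have ll' : l = l'.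
  apply: val_inj; apply: (congr1 val (x := widen_ord (leqnSn m) l) (y :=
    widen_ord (leqnSn m) l')).
  by apply: (@perm_inj _ v); rewrite -pred_eq uv // kE /= /bump /=.
by rewrite kE ll'.
Qed.

Definition tail_seq (u : {perm 'I_n}) : seq 'I_n :=
  [seq x <- [seq u j | j <- enum 'I_n] | x \notin codom h].

(* Deleting the heads h i loses no information: each of them comes right      *)
(* after the other endpoint of a i.                                           *)
Lemma oriented_inj u v : oriented u -> oriented v -> tail_seq u = tail_seq v ->
  u = v.
Proof.
move=> ou ov uv; suff H k : forall j : 'I_n, j < k -> u j = v j.
  by apply/permP => j; exact: (H j.+1).
elim: k => [//|k IH] j; rewrite ltnS leq_eqVlt => /orP[/eqP jk|];
  last exact: IH.
rewrite -jk in IH.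
have [/codomP[i ui]|un] := boolP (u j \in codom h).
  by rewrite ui (oriented_step ou ov IH ui).
have [/codomP[i vi]|vn] := boolP (v j \in codom h).
  by rewrite vi; apply: (oriented_step ov ou _ vi) => j' /IH.
have jE : enum 'I_n = take j (enum 'I_n) ++ j :: drop j.+1 (enum 'I_n).
  rewrite -[LHS](cat_take_drop j) (drop_nth j) ?size_enum_ord ?ltn_ord //.
  by rewrite nth_ord_enum.
move: uv; rewrite /tail_seq jE !map_cat !filter_cat /= un vn.
have -> : [seq u i | i <- take j (enum 'I_n)] = [seq v i | i <- take j (enum
  'I_n)].
  apply/eq_in_map => i /(map_f val); rewrite map_take val_enum_ord.
  rewrite take_iota mem_iota add0n => /andP[_ ij]; apply: IH.
  by apply: leq_trans ij (geq_minl _ _).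
by move=> /(congr1 (drop (size [seq x <- [seq v i | i <- take j (enum 'I_n)] |
  x \notin codom h]))); rewrite !drop_size_cat // => -[].
Qed.

(** The heads are distinct, as an edge of a path is determined by its later endpoint; by
    [oriented_inj] the order of the [n - t] other vertices determines [u]. *)
Lemma card_oriented : injective a -> #|[set u | oriented u]| <= (n - t)`!.
Proof.
move=> inja; set V := [set u | _].
have [->|[u0 u0V]] := set_0Vmem V; first by rewrite cards0.
have injh : injective h.
  move=> i j hij; apply: inja; move: u0V; rewrite inE => /forallP ou.
  have /existsP[l /andP[/eqP ul /eqP uh]] := ou i.
  have /existsP[l' /andP[/eqP ul' /eqP uh']] := ou j.
  rewrite -ul -ul'; congr path_edge; apply: (@lift_inj _ ord0).
  by apply: (@perm_inj _ u0); rewrite uh uh'.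
have cardC : #|[predC codom h]| = n - t.
  have := cardC (mem (codom h)); rewrite card_codom // !card_ord => /(congr1
    (subn^~ t)).
  by rewrite addKn.
have size_tail u : size (tail_seq u) = n - t.
  rewrite -cardC -(card_uniqP _) ?filter_uniq //; last first.
    by rewrite map_inj_uniq ?enum_uniq //; exact: perm_inj.
  apply: eq_card => x; rewrite mem_filter !inE andbC; case: mapP => // -[].
  by exists (u^-1 x)%g; rewrite ?mem_enum // permKV.
pose F (u : {perm 'I_n}) : {ffun 'I_(n - t) -> 'I_n} :=
  [ffun i : 'I_(n - t) => nth ord0 (tail_seq u) i].
have injF : {in V &, injective F}.
  move=> u v; rewrite !inE => ou ov /ffunP uv; apply: oriented_inj => //.
  apply: (@eq_from_nth _ ord0); rewrite ?size_tail // => i lt.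
  by have := uv (Ordinal lt); rewrite !ffunE.
rewrite -(card_in_imset injF) -ffactnn -[X in _ ^_ X]card_ord -[X in X ^_
  _]cardC.
rewrite -card_inj_ffuns_on; apply/subset_leq_card/fintype.subsetP.
move=> _ /imsetP[u _ ->]; rewrite inE; apply/andP; split.
  apply/ffun_onP => i; rewrite ffunE.
  have : nth ord0 (tail_seq u) i \in tail_seq u by rewrite mem_nth ?size_tail.
  by rewrite mem_filter => /andP[].
apply/injectiveP => i j; rewrite !ffunE => /eqP.
rewrite nth_uniq ?size_tail // ?filter_uniq //.
  by move/eqP/val_inj.
by rewrite map_inj_uniq ?enum_uniq //; exact: perm_inj.
Qed.

End Oriented.

(** [card_oriented] is summed over the [2 ^ t] choices of a head in each edge. *)
Lemma card_paths_through t (a : 'I_t -> {set 'I_n}) : injective a ->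
    (forall i, #|a i| = 2) ->
  #|[set u | [forall i, exists l, path_edge u l == a i]]| <= 2 ^ t * (n - t)`!.
Proof.
move=> inja a2; pose C : pred {ffun 'I_t -> 'I_n} := family (fun i => mem (a
  i)).
have <- : #|C| = 2 ^ t.
  rewrite /C card_family foldrE big_map big_enum /=.
  by rewrite (eq_bigr (fun=> 2)) ?prod_nat_const ?card_ord.
apply: leq_trans (card_bigcup_le (F := fun h : {ffun 'I_t -> 'I_n} => [set u |
  oriented a h u]) _); last first.
  by move=> h _; exact: card_oriented.
apply/subset_leq_card/fintype.subsetP => u; rewrite inE => /forallP ua.
have [l lE] : exists l, forall i, path_edge u (l i) = a i.
  apply: (fin_all_exists (P := fun i l => path_edge u l = a i)) => i.
  by have /existsP[l /eqP] := ua i; exists l.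
apply/bigcupP; exists [ffun i => u (lift ord0 (l i))].
  by apply/familyP => i; rewrite ffunE /= -lE; exact: finset.set22.
rewrite inE; apply/forallP => i; apply/existsP; exists (l i).
by rewrite ffunE lE !eqxx.
Qed.

(** Given a path through the edges [a i], the order of its edges is prescribed at the [t] labels
    [k i]. *)
Lemma card_placed_paths t (a : 'I_t -> {set 'I_n}) (k : 'I_t -> 'I_m) :
    injective k ->
  #|[set c : {perm 'I_n} * {perm 'I_m} |
      [forall i, path_edge c.1 (c.2 (k i)) == a i]]| <=
  2 ^ t * (n - t)`! * (m - t)`!.
Proof.
move=> injk; set V := [set c | _].
have [->|[c0 c0V]] := set_0Vmem V; first by rewrite cards0.
have aE i : a i = path_edge c0.1 (c0.2 (k i)).
  by move: c0V; rewrite inE => /forallP/(_ i)/eqP.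
have inja : injective a.
  by move=> i j; rewrite !aE => /path_edge_inj/perm_inj/injk.
have a2 i : #|a i| = 2 by rewrite aE card_path_edge.
apply: leq_trans (leq_mul (card_paths_through inja a2) (leqnn _)).
apply: card_pairset_le => [u v|u _].
  rewrite !inE /= => /forallP uv; apply/forallP => i; apply/existsP.
  by exists (v (k i)).
set W := [set v | _].
have [->|[v0 v0W]] := set_0Vmem W; first by rewrite cards0.
have := card_perm_agree (v0 \o k) injk; rewrite card_ord; apply: leq_trans.
apply/subset_leq_card/fintype.subsetP => v; rewrite !inE /= in v0W * =>
  /forallP vP.
apply/forallP => i; move/forallP/(_ i)/eqP: v0W => v0E.
by apply/eqP/(@path_edge_inj u); rewrite (eqP (vP i)) /= v0E.
Qed.

End Paths.

(** * Powers against falling factorials *)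

Lemma expn_succ_bernoulli m a : a <= m.+1 -> m.+1 ^ a * (m.+1 - a) <= m ^ a *
  m.+1.
Proof.
elim: a => [_|a IH lt]; first by rewrite !expn0 subn0.
rewrite !expnS; have := IH (ltnW lt).
have : m.+1 * (m.+1 - a.+1) <= m * (m.+1 - a) by nia.
move: (m.+1 ^ a) (m ^ a) => u v h1 h2.
apply: (@leq_trans (m * (u * (m.+1 - a)))); first by nia.
by rewrite -mulnA leq_mul2l h2 orbT.
Qed.

(* Bernoulli's inequality is sharp enough for exponents up to m.+1 / 2 only,  *)
(* so t is cut into two halves.                                               *)
Lemma expn_succ_le m t : t <= m -> m.+1 ^ t <= 4 * m ^ t.
Proof.
have half a : 2 * a <= m.+1 -> m.+1 ^ a <= 2 * m ^ a.
  move=> le; have := @expn_succ_bernoulli m a.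
  rewrite -(@leq_pmul2r m.+1 (m.+1 ^ a)) // => /(_ ltac:(lia)).
  by move: (m.+1 ^ a) (m ^ a) => u v h; nia.
move=> tm; have -> : t = t./2 + uphalf t by rewrite addnC uphalf_half; lia.
rewrite !expnD; have := half t./2; have := half (uphalf t).
rewrite uphalf_half => /(_ ltac:(lia)) h1 /(_ ltac:(lia)) h2.
by have := leq_mul h2 h1; lia.
Qed.

(** Each factor split off the falling factorial costs one use of [expn_succ_le]. *)
Lemma expn_le_ffact n t : t <= n -> n ^ t <= 4 ^ t * n ^_ t.
Proof.
elim: t n => [|t IH] [|m] // tm.
rewrite ffactnS !expnS /=; have := IH m tm; have := @expn_succ_le m t tm.
move: (m.+1 ^ t) (m ^ t) (4 ^ t) (m ^_ t) => a b c d h1 h2.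
have : a <= 4 * (c * d) by apply: leq_trans h1 _; rewrite leq_mul2l h2 orbT.
by move=> h; have := leq_mul (leqnn m.+1) h; lia.
Qed.

(** * The spread family of matched Hamilton paths *)

Section PathRows.
Variables (s m : nat).
Notation n := m.+1.
Notation N := 'C(n, 2).
Variables (z0 : 'I_N) (f : 'I_N -> {set 'I_n}) (idx : {set 'I_n} -> 'I_N).
Hypothesis idxK : forall e, e \in complete_edges n -> f (idx e) = e.

Definition path_row (th : {ffun 'I_s -> {perm 'I_n} * {perm 'I_m}}) (k : 'I_m) :
    {ffun 'I_s -> 'I_N} :=
  [ffun j => idx (path_edge (th j).1 ((th j).2 k))].

Definition path_rows (th : {ffun 'I_s -> {perm 'I_n} * {perm 'I_m}}) :
    {set {ffun 'I_s -> 'I_N}} := [set path_row th k | k in [set: 'I_m]].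

Lemma path_edge_complete (u : {perm 'I_n}) l : path_edge u l \in complete_edges
  n.
Proof. by rewrite inE card_path_edge. Qed.

Lemma path_rowE th k j : f (path_row th k j) = path_edge (th j).1 ((th j).2 k).
Proof. by rewrite ffunE idxK ?path_edge_complete. Qed.

Lemma path_rows_match th x y j : x \in path_rows th -> y \in path_rows th ->
  x j = y j -> x = y.
Proof.
case/imsetP=> k _ -> /imsetP[k' _ ->] /(congr1 f).
by rewrite !path_rowE => /path_edge_inj/perm_inj ->.
Qed.

Lemma card_path_rows th : #|path_rows th| <= m.
Proof. by rewrite (leq_trans (leq_imset_card _ _)) // cardsT card_ord. Qed.

(** The labels of the rows of [T] are chosen once for all coordinates, in [m ^_ t <= n ^ t] ways.
    Given them, each coordinate keeps a fraction [2 ^ t / (n ^_ t * m ^_ t)] of the choices, at most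
    [(16 / N) ^ t]. *)
Lemma path_rows_spread (T : {set {ffun 'I_s -> 'I_N}}) :
  #|[set th | T \subset path_rows th]| * N ^ (s * #|T|) <=
  #|{ffun 'I_s -> {perm 'I_n} * {perm 'I_m}}| * (16 ^ s * n) ^ #|T|.
Proof.
move Tt: #|T| => t; pose x := @elt s _ z0 t T.
have le1 : #|[set th | T \subset path_rows th]| <=
    m ^_ t * (2 ^ t * (n - t)`! * (m - t)`!) ^ s.
  have <- : #|[pred k : {ffun 'I_t -> 'I_m} | injectiveb k]| = m ^_ t.
    by have := card_inj_ffuns 'I_t 'I_m; rewrite !card_ord cardsE.
  pose V (k : {ffun 'I_t -> 'I_m}) :=
    [set th : {ffun 'I_s -> {perm 'I_n} * {perm 'I_m}} | [forall j,
      th j \in [set c : {perm 'I_n} * {perm 'I_m} |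
        [forall i, path_edge c.1 (c.2 (k i)) == f (x i j)]]]].
  apply: leq_trans (card_bigcup_le (F := V) _); last first.
    move=> k /injectiveP injk; pose G j := [set c : {perm 'I_n} * {perm 'I_m} |
        [forall i, path_edge c.1 (c.2 (k i)) == f (x i j)]].
    have -> : #|V k| = #|family (fun j => mem (G j))|.
      by apply: eq_card => th; rewrite inE.
    rewrite card_family foldrE big_map big_enum /=.
    rewrite -[X in _ <= _ ^ X]card_ord -prod_nat_const; apply: leq_prod => j _.
    exact: (card_placed_paths (fun i => f (x i j)) injk).
  apply/subset_leq_card/fintype.subsetP => th;
    rewrite inE => /fintype.subsetP sub.
  have [k kE] : exists k : 'I_t -> 'I_m, forall i, x i = path_row th (k i).
    apply: (fin_all_exists (P := fun i k => x i = path_row th k)) => i.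
    by have /imsetP[k _] := sub _ (elt_in z0 i Tt); exists k.
  apply/bigcupP; exists (finfun k).
    apply/injectiveP => i j; rewrite !ffunE => kij.
    by apply: (elt_inj (z0 := z0) Tt); rewrite -/x -[LHS]/(x i) -[RHS]/(x j)
      !kE kij.
  rewrite inE; apply/forallP => j; rewrite inE; apply/forallP => i.
  by rewrite ffunE kE path_rowE.
apply: leq_trans (leq_mul le1 (leqnn _)) _.
have [tm|/ffact_small ->] := leqP t m; last by [].
have N2 : 2 * N = n * m by rewrite -mul_bin_diag bin1.
rewrite card_ffun card_prod !card_ord -!cardsT.
have -> : #|[set: {perm 'I_n}]| = n`! by rewrite cardsT card_Sn.
have -> : #|[set: {perm 'I_m}]| = m`! by rewrite cardsT card_Sn.
rewrite -(ffact_fact tm) -(ffact_fact (leqW tm)).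
move: ((n - t)`!) ((m - t)`!) => A B.
(* Here [2 * N = n * m], and [n ^ t] and [m ^ t] each lose [4 ^ t] against their falling
   factorials. *)
have key : 2 ^ t * N ^ t <= 16 ^ t * (n ^_ t * m ^_ t).
  rewrite -expnMn N2 expnMn -[16]/(4 * 4) expnMn.
  have := leq_mul (expn_le_ffact (leqW tm)) (expn_le_ffact tm).
  by rewrite mulnACA.
have mt : m ^_ t <= n ^ t.
  elim: t {tm key le1 x Tt} m => [|t IH] [|k] //; rewrite ffactnS expnS /=.
  by apply: leq_mul => //; apply: leq_trans (IH k) _; exact: leq_expn_base.
rewrite (mulnC s t) expnM -mulnA -expnMn.
apply: (@leq_trans (n ^ t * (16 ^ t * (n ^_ t * m ^_ t) * (A * B)) ^ s)).
  apply: leq_mul mt _; apply: leq_expn_base.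
  have := leq_mul key (leqnn (A * B)); apply: leq_trans; rewrite leq_eqVlt.
  by apply/orP; left; apply/eqP; lia.
rewrite !expnMn -!expnM (mulnC t s); lia.
Qed.

End PathRows.

(** * A Hamilton path is a spanning tree *)

Section PathTree.
Variables (m : nat) (u : {perm 'I_m.+1}).

Let F : {set {set 'I_m.+1}} := [set path_edge u l | l in [set: 'I_m]].

Lemma adj_path x y : adj F x y =
  (((u^-1)%g x).+1 == ((u^-1)%g y) :> nat) || (((u^-1)%g y).+1 == ((u^-1)%g x)
    :> nat).
Proof.
apply/andP/idP => [[xy /imsetP[l _ xyE]]|].
  have : x \in path_edge u l by rewrite -xyE finset.set21.
  have : y \in path_edge u l by rewrite -xyE finset.set22.
  rewrite !inE => /orP[] /eqP yE /orP[] /eqP xE; move: xy;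
    rewrite xE yE ?eqxx //.
    by rewrite !permK /= /bump /= add1n eqxx orbT.
  by rewrite !permK /= /bump /= add1n eqxx.
have in_F a b : ((u^-1)%g a).+1 = ((u^-1)%g b) :> nat -> [set a; b] \in F.
  move=> ab; have lt : (u^-1)%g a < m by rewrite -ltnS ab ltn_ord.
  apply/imsetP; exists (Ordinal lt) => //; rewrite /path_edge.
  have -> : widen_ord (leqnSn m) (Ordinal lt) = (u^-1)%g a by apply: val_inj.
  have -> : lift ord0 (Ordinal lt) = (u^-1)%g b by apply: val_inj.
  by rewrite !permKV.
case/orP=> /eqP ab; split.
- by apply: contra_eqN ab => /eqP ->; lia.
- exact: in_F.
- by apply: contra_eqN ab => /eqP ->; lia.
by rewrite finset.setUC; exact: in_F.
Qed.

Lemma spanning_tree_path : spanning_tree F.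
Proof.
apply/and3P; split.
- by apply/fintype.subsetP => _ /imsetP[l _ ->]; exact: path_edge_complete.
- have sym : connect_sym (adj F).
    by apply: sym_connect_sym => x y; rewrite !adj_path orbC.
  have from0 k (lt : k < m.+1) : connect (adj F) (u ord0) (u (Ordinal lt)).
    elim: k lt => [|k IH] lt.
      by have -> : Ordinal lt = ord0 by exact: val_inj.
    apply: connect_trans (IH (ltnW lt)) (connect1 _).
    by rewrite adj_path !permK eqxx.
  apply/forallP => x; apply/forallP => y.
  have root z : connect (adj F) (u ord0) z.
    have := from0 _ (ltn_ord ((u^-1)%g z)).
    have -> : Ordinal (ltn_ord ((u^-1)%g z)) = (u^-1)%g z by exact: val_inj.
    by rewrite permKV.
  by apply: connect_trans (root y); rewrite sym.
apply/acyclic_graphP => c c_gt2 /andP[cyc uniq_c].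
have [x0 x0c] : exists x, x \in c by case: c c_gt2 {cyc uniq_c} => // x c _;
  exists x; rewrite mem_head.
pose pos (x : 'I_m.+1) : nat := (u^-1)%g x.
(* Let [x] be the vertex of the cycle furthest along the path: both its neighbours in the cycle sit
   one position earlier, hence coincide, which three distinct vertices exclude. *)
case: (@arg_maxnP _ x0 (mem c) pos x0c) => x /= xc max_x.
have [i c' rotE] := rot_to xc.
have mem_c' z : z \in x :: c' -> pos z <= pos x.
  by rewrite -rotE mem_rot => /max_x.
have : path.cycle (adj F) (x :: c') by rewrite -rotE rot_cycle.
have : uniq (x :: c') by rewrite -rotE rot_uniq.
have : 2 < size (x :: c') by rewrite -rotE size_rot.
case: c' mem_c' {rotE} => [|y [|z c']] // mem_c' _.
rewrite /= rcons_path => /and3P[_ ync _] /and3P[xy _ /andP[_ lx]].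
have before v : v \in [:: x, y, z & c'] -> adj F x v -> (pos v).+1 = pos x.
  by move=> /mem_c'; rewrite adj_path /pos => le /orP[] /eqP; lia.
have lastP : last z c' \in z :: c' by exact: mem_last.
have : pos (last z c') = pos y.
  apply: succn_inj; rewrite !before //; first by rewrite !inE eqxx orbT.
    by rewrite inE [X in _ || X]inE lastP !orbT.
  by rewrite adj_path orbC -adj_path.
by move=> /val_inj/perm_inj E; move: ync; rewrite -E lastP.
Qed.

End PathTree.

(** * Orderings as permutations of positions *)

Section Relabel.
Variables (s m : nat).
Notation n := m.+1.
Notation N := 'C(n, 2).
Variables (f : ordering n) (z0 : 'I_N).

Definition edge_index (e : {set 'I_n}) : 'I_N :=
  odflt z0 [pick i | val f i == e].

Lemma edge_indexK e : e \in complete_edges n -> val f (edge_index e) = e.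
Proof.
have /andP[_ /eqP im] := valP f => ein.
have /imsetP[i _ ->] : e \in [set val f i | i in [set: 'I_N]] by rewrite im.
by rewrite /edge_index; case: pickP => [j /eqP //|/(_ i)]; rewrite eqxx.
Qed.

Lemma relabel_subproof (v : {perm 'I_N}) (g := [ffun i => val f (v i)]) :
  injectiveb g && (g @: [set: 'I_N] == complete_edges n).
Proof.
have /andP[/injectiveP injf /eqP im] := valP f; apply/andP; split.
  by apply/injectiveP => i j; rewrite !ffunE => /injf/perm_inj.
apply/eqP; rewrite -[RHS]im; apply/finset.setP => e.
apply/imsetP/imsetP => -[i _ ->].
  by exists (v i) => //; rewrite ffunE.
by exists ((v^-1)%g i) => //; rewrite ffunE permKV.
Qed.

Definition relabel (w : {ffun 'I_s -> {perm 'I_N}}) : orderings s n :=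
  [ffun j => exist (fun g : {ffun 'I_N -> {set 'I_n}} =>
    injectiveb g && (g @: [set: 'I_N] == complete_edges n)) _ (relabel_subproof
      (w j))].

Lemma relabelE w j i : val (relabel w j) i = val f (w j i).
Proof. by rewrite ffunE /= ffunE. Qed.

Lemma relabel_inj : injective relabel.
Proof.
have /andP[/injectiveP injf _] := valP f.
move=> v w vw; apply/ffunP => j; apply/permP => i; apply: injf.
by rewrite -!relabelE vw.
Qed.

(** Together with [relabel_inj] this makes [relabel] a bijection, so the two uniform measures
    correspond. *)
Lemma card_orderings_le : #|orderings s n| <= #|{ffun 'I_s -> {perm 'I_N}}|.
Proof.
rewrite !card_ffun; apply: leq_expn_base.
rewrite card_Sn -ffactnn.
rewrite -[X in X ^_ _]card_complete_edges -[X in _ ^_ X]card_ord.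
rewrite -card_inj_ffuns_on -(card_imset _ val_inj).
apply/subset_leq_card/fintype.subsetP => _ /imsetP[g _ ->].
have /andP[injg /eqP imE] := valP g; rewrite inE injg andbT.
apply/ffun_onP => i; have : val g i \in [set val g i | i in [set: 'I_N]] by
  exact: imset_f.
by rewrite imE.
Qed.

Lemma covers_MultiTree (w : {ffun 'I_s -> {perm 'I_N}}) M :
  covers (path_rows edge_index) w (pre N M) finset.set0 ->
  prefix_contains_MultiTree (relabel w) M.
Proof.
case/existsP=> th; rewrite finset.setU0 => /fintype.subsetP cov.
(* Only positions whose row belongs to the member are kept; in ordering [j] they carry exactly the
   edges of the path [(th j).1]. *)
pose I := [set i in pre N M | row w i \in path_rows edge_index th].
apply/existsP; exists I; apply/andP; split.
  by apply/fintype.subsetP => i; rewrite !inE => /andP[].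
apply/forallP => j; have := spanning_tree_path (th j).1; congr spanning_tree.
apply/finset.setP => e; apply/imsetP/imsetP => [[l _ ->]|[i]].
  pose x := path_row edge_index th (((th j).2)^-1 l)%g.
  have xP : x \in path_rows edge_index th by exact: imset_f.
  have /imsetP[i iM xE] := cov x xP; exists i; first by rewrite inE iM -xE.
  have /ffunP/(_ j) := xE; rewrite [RHS]ffunE relabelE => <-.
  by rewrite (path_rowE edge_indexK) permKV.
rewrite inE => /andP[_ /imsetP[k _ rowE]] ->.
exists ((th j).2 k) => //; rewrite relabelE.
by have /ffunP/(_ j) := rowE; rewrite ffunE => ->;
  rewrite (path_rowE edge_indexK).
Qed.

End Relabel.

(** * MultiTrees in prefixes *)

Lemma unlikely_no_MultiTree s m rho a L (K := 16 ^ s * m.+1)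
    (M := a * (s.+2 * m + 16 * K) + (s.+2 * m + L * K)) :
    0 < s -> 0 < m -> 0 < rho -> m <= 2 ^ a -> 0 < L -> M <= 'C(m.+1, 2) ->
  #|[set w : orderings s m.+1 | ~~ prefix_contains_MultiTree w M]| * (2 ^ rho *
    L) <=
    #|orderings s m.+1| * (L + 4 ^ rho).
Proof.
move=> s0 m0 rho0 ma L0 MN.
have N0 : 0 < 'C(m.+1, 2) by rewrite bin_gt0.
have [f _] := card_gt0P (ordering_gt0 m.+1).
pose z0 := Ordinal N0; pose j0 := Ordinal s0.
pose G := [set w : {ffun 'I_s -> {perm 'I_'C(m.+1, 2)}} |
  ~~ covers (path_rows (edge_index f z0)) w (pre _ M) finset.set0].
have idxK := @edge_indexK m f z0.
have K0 : 0 < K by rewrite muln_gt0 expn_gt0.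
have cardO : #|orderings s m.+1| = #|{ffun 'I_s -> {perm 'I_'C(m.+1, 2)}}|.
  apply/eqP; rewrite eqn_leq card_orderings_le //=.
  rewrite -(card_imset _ (@relabel_inj s m f)); exact: max_card.
have sub : [set w : orderings s m.+1 | ~~ prefix_contains_MultiTree w M] \subset
    @relabel s m f @: G.
  apply/fintype.subsetP => w; rewrite inE => nw.
  have /imsetP[v _ wE] : w \in @relabel s m f @: [set: _].
    suff -> : @relabel s m f @: [set: _] = [set: _] by rewrite inE.
    apply/eqP; rewrite eqEcard finset.subsetT /= card_imset;
      last exact: relabel_inj.
    by rewrite !cardsT cardO.
  rewrite wE imset_f // inE; apply: contra nw => /covers_MultiTree.
  by rewrite wE.
apply: (@leq_trans (#|G| * (2 ^ rho * L))).
  rewrite leq_mul2r; apply/orP; right.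
  by apply: leq_trans (subset_leq_card sub) _; rewrite card_imset //;
    exact: relabel_inj.
rewrite cardO.
apply: (unlikely_uncovered j0 z0 (path_rows_match idxK) (@card_path_rows _ _
  _)) => //.
- by move=> T; exact: (path_rows_spread z0 idxK).
- by apply: leq_trans ma _; rewrite leq_pmull.
by apply/card_gt0P; exists [ffun=> (1%g, 1%g)].
Qed.

(** [D] precedes [k], so one constant serves every error [2 / k]. With [rho = k] and [a = L = t.+1],
    the failure probability is at most [2 ^ (- k) + 2 ^ k / t.+1]. *)
Lemma MultiTree_whp s : 0 < s -> exists D, forall k, 0 < k ->
  exists n0, forall n, n0 <= n -> exists M,
    [/\ M <= D * (n * trunc_log 2 n), M <= 'C(n, 2) &
      #|[set w : orderings s n | ~~ prefix_contains_MultiTree w M]| * k <=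
        #|orderings s n| * 2].
Proof.
move=> s0; pose E := 2 * s.+2 + 17 * 16 ^ s; exists (2 * E) => k k0.
(* The part [8 * E + 4] makes [M] fit into ['C(n, 2)]; the part [k * 2 ^ k] makes [2 ^ k / t.+1] at
   most [1 / k]. *)
exists (2 ^ (8 * E + 4 + k * 2 ^ k)) => -[|m] nle.
  by move: nle; rewrite leqNgt expn_gt0.
set t := trunc_log 2 m.+1.
have [tn nt] : 2 ^ t <= m.+1 /\ m.+1 < 2 ^ t.+1.
  by split; [exact: trunc_logP | exact: trunc_log_ltn].
have tE : 8 * E + 4 + k * 2 ^ k <= t.
  by rewrite -ltnS -(@ltn_exp2l 2) //; exact: leq_ltn_trans nle nt.
(* Thus [n] is at least quadratic in [t], which beats the linear bound needed in [Em]. *)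
have sq : (t./2).+1 * (t./2).+1 <= m.+1.
  apply: leq_trans tn; rewrite -[X in _ <= 2 ^ X](odd_double_half t) expnD
    -addnn expnD.
  apply: (@leq_trans (2 ^ t./2 * 2 ^ t./2)); last by rewrite leq_pmull //
    expn_gt0.
  by apply: leq_mul; exact: ltn_expl.
have Em : 2 * (t.+1 * E) <= m.
  have : t < (t./2).+1 * 2 by have := odd_double_half t; lia.
  move: (t./2).+1 sq tE => h sq tE th.
  have : h * (4 * E + 1) <= h * h by rewrite leq_mul2l; apply/orP; right; lia.
  nia.
pose M := t.+1 * (s.+2 * m + 16 * (16 ^ s * m.+1)) +
  (s.+2 * m + t.+1 * (16 ^ s * m.+1)).
have ME : M <= t.+1 * E * m.+1.
  rewrite /M /E; move: (16 ^ s) => c; nia.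
have t0 : 0 < t by lia.
have MN : M <= 'C(m.+1, 2).
  apply: leq_trans ME _.
  have N2 : 2 * 'C(m.+1, 2) = m.+1 * m by rewrite -mul_bin_diag bin1.
  rewrite -(@leq_pmul2l 2) // N2 mulnA mulnC leq_mul2l.
  by move: Em; rewrite mulnA => ->; rewrite orbT.
exists M; split=> //; first by apply: leq_trans ME _; nia.
have m0 : 0 < m by lia.
have mt : m <= 2 ^ t.+1 by exact: ltnW (ltnW nt).
have := unlikely_no_MultiTree s0 m0 k0 mt (ltn0Sn t) MN.
rewrite -/M; set x := #|_|; set y := #|_| => h.
have tk : k * 2 ^ k <= t.+1 by lia.
have kk : k <= 2 ^ k by rewrite ltnW // ltn_expl.
have e4 : 4 ^ k = 2 ^ k * 2 ^ k by rewrite -expnMn.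
have u0 : 0 < 2 ^ k * t.+1 by rewrite muln_gt0 expn_gt0.
rewrite -(leq_pmul2r u0); rewrite e4 in h.
move: (2 ^ k) (t.+1) tk kk h {e4 u0 sq Em ME tn nt MN mt} => u L tk kk h.
apply: (@leq_trans (y * (L + u * u) * k)).
  by rewrite mulnAC leq_mul2r h orbT.
rewrite -!mulnA leq_mul2l; apply/orP; right.
have := leq_mul tk (leqnn u); have := leq_mul kk (leqnn L); lia.
Qed.

Unset Implicit Arguments.
Local Open Scope classical_set_scope.
Local Open Scope ring_scope.

Theorem theorem1 (R : realType) (s : nat) (hs : (2 <= s)%N) :
  exists C : R,
    (fun n : nat =>
       Pr R [set w : orderings s n |
              (mstar R w <= (C * n%:R * ln (n%:R : R))%:E)%E]%SET) @ \oo
      --> (1 : R).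
Proof.
have [D whp] := MultiTree_whp (ltnW hs).
have ln2_gt0 : 0 < ln (2 : R) by rewrite ln_gt0 // ltr1n.
(* Dividing by [ln 2] converts the binary logarithm of [MultiTree_whp] into [ln]. *)
exists (D%:R / ln 2); apply/cvgrPdist_lt => e e0.
pose k := (Num.Def.archi_bound (2 / e)).
have ke : 2 / e < k%:R by apply: archi_boundP; rewrite divr_ge0 // ltW.
have k0 : (0 < k)%N by rewrite -(ltr_nat R); apply: le_lt_trans ke;
  rewrite divr_ge0 // ltW.
have [n0 {}whp] := whp k k0.
exists n0.+1 => // n /= n0n; have [M [MD MN few]] := whp n (ltnW n0n).
set A := [set w | _]%SET.
have n_gt0 : (0 < n)%N by exact: leq_ltn_trans n0n.
have trunc_ln : (trunc_log 2 n)%:R * ln 2 <= ln (n%:R : R).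
  rewrite mulr_natl -lnXn // ler_ln ?posrE ?exprn_gt0 ?ltr0n // -natrX ler_nat.
  exact: trunc_logP.
have MC : M%:R <= D%:R / ln 2 * n%:R * ln (n%:R : R).
  apply: (@le_trans _ _ (D * (n * trunc_log 2 n))%:R); first by rewrite ler_nat.
  rewrite !natrM -!mulrA ler_wpM2l // mulrCA ler_wpM2l // mulrC ler_pdivlMr //.
have sub :
    (~: A \subset
     [set w : orderings s n | ~~ prefix_contains_MultiTree w M])%SET.
  apply/fintype.subsetP => w; rewrite !inE; apply: contra => PM.
  apply: (@le_trans _ _ (M%:R%:E)); last by rewrite lee_fin.
  (* [MN] puts [M] in the index range of the minimum that defines [mstar]. *)
  exact: (bigmin_le_cond _ (j := Ordinal (MN : (M < 'C(n, 2).+1)%N))).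
have O_gt0 : (0 : R) < #|orderings s n|%:R.
  by rewrite ltr0n card_ffun expn_gt0 ordering_gt0.
have cardA : (#|A|%:R : R) = #|orderings s n|%:R - #|~: A|%:R.
  by rewrite -(cardsC A) natrD addrK.
rewrite /Pr cardA mulrBl divff ?gt_eqF // opprB addrC subrK ger0_norm
  ?divr_ge0 //.
rewrite ltr_pdivrMr //.
have : (#|~: A|%:R * k%:R : R) <= #|orderings s n|%:R * 2.
  rewrite -!natrM ler_nat; apply: leq_trans few.
  by rewrite leq_mul2r subset_leq_card ?orbT.
rewrite -ler_pdivlMr ?ltr0n // => /le_lt_trans; apply.
rewrite ltr_pdivrMr ?ltr0n // mulrAC mulrC ltr_pM2r //.
by rewrite mulrC -ltr_pdivrMr.
Qed.
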